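(* Consider an aversive refinement schedule, with a sound oracle-free checker $V$ and accepted sets $A_0,A_1,\dots,A_K$. For every generator and every budget $K$: (i) $A_0\subseteq A_1\subseteq\cdots\subseteq A_K$; (ii) every answer in each $A_t$ is correct; (iii) $|A_t|$ is non-decreasing and is a lower bound on the generator's true accuracy; (iv) the schedule consumes no reference answer, so the gain $|A_K|-|A_0|$ counts additional correct certificates the generator can be driven to produce under checking, not information supplied by a key.
   Context: Checker: for a family of instances $x$ with an admissible-answer relation, a checker is a map $V$ sending a pair $(x,c)$ of an instance and a candidate certificate to $\{\mathsf{accept},\mathsf{reject}\}$ that is computable from $(x,c)$ alone. It is sound if $V(x,c)=\mathsf{accept}$ implies that the answer encoded by $c$ is correct, and oracle-free in that it never reads a reference answer. Aversive refinement schedule: fix a sound checker $V$ and a budget $K$. A refinement maintains an accepted set $A_t$ of items, each carrying a verified certificate. The set $A_0$ is whatever a first pass certifies. At round $t\ge1$ a generator proposes certificates for the items outside $A_{t-1}$, conditioned on a memory $M_t$ of its own previously rejected certificates together with the checker's rejection reasons for them; $V$ is applied, and items it accepts enter $A_t$ and are never revised (accepted items are retained). With $p_t$ the number of still-unverified items, the schedule greedily increases \[ J=\sum_{t}\bigl(|A_t|-\kappa\,p_t+\nu\,z_t\bigr),\qquad z_t=|A_{t-1}|, \] where $\kappa,\nu$ are weights, a rejection is the aversive term $p$, and the retained certificates are the continuity term $z$; accepted certificates are never revised, so there is no disruption term. *)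

(* Defs.v *)
From HB Require Import structures.
From mathcomp Require Import all_boot all_order all_algebra.
From mathcomp Require Import boolp.

Set Implicit Arguments.
Unset Strict Implicit.
Unset Printing Implicit Defensive.

Import Order.TTheory GRing.Theory Num.Theory.

(* General (mu-)recursive functions over finite argument lists; a missing
   argument is read as 0. *)
Inductive recfun : Type :=
| RZero
| RSucc
| RProj of nat
| RComp of recfun & seq recfun
| RPrim of recfun & recfun
| RMin of recfun.

Inductive rec_eval : recfun -> seq nat -> nat -> Prop :=
| ev_zero v : rec_eval RZero v 0
| ev_succ v : rec_eval RSucc v (nth 0 v 0).+1
| ev_proj i v : rec_eval (RProj i) v (nth 0 v i)
| ev_comp f gs v w y :
    rec_evals gs v w -> rec_eval f w y -> rec_eval (RComp f gs) v y
| ev_prim0 f g v y : rec_eval f v y -> rec_eval (RPrim f g) (0 :: v) y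
| ev_primS f g n v z y :
    rec_eval (RPrim f g) (n :: v) z -> rec_eval g [:: n, z & v] y ->
    rec_eval (RPrim f g) (n.+1 :: v) y
| ev_min f v n :
    (forall m, m < n -> exists k, rec_eval f (m :: v) k.+1) ->
    rec_eval f (n :: v) 0 -> rec_eval (RMin f) v n
with rec_evals : seq recfun -> seq nat -> seq nat -> Prop :=
| evs_nil v : rec_evals [::] v [::]
| evs_cons g gs v y w :
    rec_eval g v y -> rec_evals gs v w -> rec_evals (g :: gs) v (y :: w).

(* A procedure that may consult an answer key: [Ask x k] reads the reference
   answer of [x] and continues with it.  Modelling checkers this way makes
   "never reads a reference answer" a property of the checker rather than an
   artefact of its type. *)
Inductive oprog (X Ans Res : Type) : Type :=
| Ret of Res
| Ask of X & (Ans -> oprog X Ans Res).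

Fixpoint outcome (X Ans Res : Type) (key : X -> Ans) (p : oprog X Ans Res)
    : Res :=
  match p with
  | Ret r => r
  | Ask x k => outcome key (k (key x))
  end.

Fixpoint queries (X Ans Res : Type) (key : X -> Ans) (p : oprog X Ans Res)
    : seq X :=
  match p with
  | Ret _ => [::]
  | Ask x k => x :: queries key (k (key x))
  end.

Inductive verdict (Rsn : Type) : Type :=
| Accept
| Reject of Rsn.

Definition is_accept (Rsn : Type) (v : verdict Rsn) : bool :=
  if v is Accept then true else false.

Definition checker (X C Ans Rsn : Type) : Type :=
  X -> C -> oprog X Ans (verdict Rsn).

Definition accepts (X C Ans Rsn : Type) (V : checker X C Ans Rsn)
    (key : X -> Ans) (x : X) (c : C) : bool :=
  is_accept (outcome key (V x c)).

(* The index [e] is chosen before the key and sees only the codes of x and c;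
   computability is relative to the coding given by the countType structures. *)
Definition computable_checker (X C : countType) (Ans Rsn : Type)
    (V : checker X C Ans Rsn) : Prop :=
  exists e : recfun, forall (key : X -> Ans) (x : X) (c : C),
    rec_eval e [:: pickle x; pickle c] (accepts V key x c).

Definition sound_checker (X C Ans Rsn : Type) (correct : X -> Ans -> Prop)
    (answer : C -> Ans) (V : checker X C Ans Rsn) : Prop :=
  forall (key : X -> Ans) (x : X) (c : C),
    accepts V key x c -> correct x (answer c).

Definition oracle_free (X C Ans Rsn : Type) (V : checker X C Ans Rsn) : Prop :=
  forall (key : X -> Ans) (x : X) (c : C), queries key (V x c) = [::].

Definition rejection (T : finType) (C Rsn : Type) : Type := (T * C * Rsn)%type.

(* [gen t i M] is the certificate proposed at round [t] for item [i] given the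
   memory [M]; round 0 is the first pass.  No key is passed to it.  Dependence
   on [t] absorbs any fixed realization of internal randomness, as well as a
   first pass produced differently from the later rounds. *)
Definition generator (T : finType) (C Rsn : Type) : Type :=
  nat -> T -> seq (rejection T C Rsn) -> C.

(* [cert t i] is the certificate item [i] holds after round [t]: the retained
   one if [i] was already accepted, the latest proposal otherwise.  [memory t] is
   the memory available at round [t]; [reads t] logs every reference answer
   read in rounds 0, ..., t. *)
Record trace (T : finType) (X C Rsn : Type) : Type := Trace {
  acc : nat -> {set T};
  cert : nat -> T -> C;
  memory : nat -> seq (rejection T C Rsn);
  reads : nat -> seq X
}.

Section Schedule.
Variables (R : realFieldType) (T : finType) (X C Ans Rsn : Type).
Variables (inst : T -> X) (V : checker X C Ans Rsn).
Variables (gen : generator T C Rsn) (key : X -> Ans).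
Implicit Types (s : trace T X C Rsn) (A B : {set T}) (t : nat).

Definition retained s t : {set T} := if t is u.+1 then acc s u else set0.

Definition newly_accepted s t : {set T} :=
  [set i in ~: retained s t | accepts V key (inst i) (cert s t i)].

Definition round_rejections s t : seq (rejection T C Rsn) :=
  pmap (fun i => if outcome key (V (inst i) (cert s t i)) is Reject r
                 then Some (i, cert s t i, r) else None)
       (enum (~: retained s t)).

Definition round_reads s t : seq X :=
  flatten [seq queries key (V (inst i) (cert s t i))
          | i <- enum (~: retained s t)].

Local Open Scope ring_scope.

Variables kappa nu : R.

(* |A_t| - kappa p_t + nu z_t, as a function of A_{t-1} and A_t *)
Definition round_value (Aprev Acur : {set T}) : R :=
  #|Acur|%:R - kappa * #|~: Acur|%:R + nu * #|Aprev|%:R.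

(* z_t refers to A_{t-1}, so the sum starts at t = 1. *)
Definition objective s t : R :=
  \sum_(1 <= u < t.+1) round_value (acc s u.-1) (acc s u).

(* Given the past, no set that retains A_{t-1} and otherwise contains only
   items accepted at round t would give a larger J up to round t. *)
Definition greedy s t : Prop :=
  forall B : {set T},
    retained s t \subset B ->
    B \subset retained s t :|: newly_accepted s t ->
    objective s t.-1 + round_value (acc s t.-1) B <= objective s t.

Record aversive_schedule (K : nat) s : Prop := AversiveSchedule {
  sched_cert : forall t i, (t <= K)%N ->
    cert s t i = if i \in retained s t then cert s t.-1 i
                 else gen t i (memory s t);
  sched_acc : forall t, (t <= K)%N ->
    acc s t = retained s t :|: newly_accepted s t;
  sched_mem0 : memory s 0 = [::];
  sched_memS : forall t, (t < K)%N ->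
    memory s t.+1 = memory s t ++ round_rejections s t;
  sched_reads0 : reads s 0 = round_reads s 0;
  sched_readsS : forall t, (t < K)%N ->
    reads s t.+1 = reads s t ++ round_reads s t.+1;
  sched_greedy : forall t, (0 < t <= K)%N -> greedy s t
}.

End Schedule.

Section Accuracy.
Variables (T : finType) (X C Ans Rsn : Type) (inst : T -> X).
Variables (correct : X -> Ans -> Prop) (answer : C -> Ans).

(* All answers the generator currently stands by count, verified or not. *)
Definition num_correct (s : trace T X C Rsn) (t : nat) : nat :=
  #|[set i | `[< correct (inst i) (answer (cert s t i)) >]]|.

Definition true_accuracy (R : realFieldType) (s : trace T X C Rsn) (t : nat)
    : R := ((num_correct s t)%:R / #|T|%:R)%R.

(* Items left open by the first pass for which the generator, at some round
   1 <= t <= K, itself proposed a correct certificate that V accepted and that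
   is the one held at the end. *)
Definition driven_items (V : checker X C Ans Rsn) (gen : generator T C Rsn)
    (key : X -> Ans) (K : nat) (s : trace T X C Rsn) : {set T} :=
  [set i | (i \notin acc s 0) &&
     `[< exists t, [/\ 0 < t <= K,
           cert s K i = gen t i (memory s t),
           accepts V key (inst i) (gen t i (memory s t)) &
           correct (inst i) (answer (gen t i (memory s t)))] >]].

End Accuracy.

(* Main.v *)
Require Import Defs.
From HB Require Import structures.
From mathcomp Require Import all_boot all_order all_algebra.
From mathcomp Require Import boolp.

Set Implicit Arguments.
Unset Strict Implicit.
Unset Printing Implicit Defensive.

Import Order.TTheory GRing.Theory Num.Theory.

(** Each round adds to the retained set exactly the proposals that [V] accepts, so the sets grow and
    the certificate of an accepted item is frozen from its entry round on ([cert_retained]).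
    Acceptance on entry therefore persists ([acc_accepts]), and soundness turns it into correctness,
    which gives the accuracy bound by counting. For (iv), a program that asks nothing is a bare
    [Ret], so its outcome is the same under every key; by induction on rounds, schedules run under
    two keys coincide up to round [K] ([schedule_key_independent]). The gain is identified in
    [driven_itemsE], by looking at the first round in which an item is accepted. *)

(** An [Ask] logs its query before branching on the answer, so an empty log under a single key
    already forces [p] to be a [Ret]. *)
Lemma outcome_no_queries (X Ans Res : Type) (key key' : X -> Ans)
    (p : oprog X Ans Res) :
  queries key p = [::] -> outcome key' p = outcome key p.
Proof. by case: p. Qed.

Section ScheduleTheory.
Variables (R : realFieldType) (T : finType) (X C Ans Rsn : Type).
Variables (inst : T -> X) (V : checker X C Ans Rsn).
Variables (gen : generator T C Rsn) (kappa nu : R) (K : nat).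

Section OneTrace.
Variables (key : X -> Ans) (s : trace T X C Rsn).
Hypothesis hs : aversive_schedule inst V gen key kappa nu K s.

Lemma acc_subS t : t < K -> acc s t \subset acc s t.+1.
Proof. by move=> tK; rewrite (sched_acc hs tK) subsetUl. Qed.

Lemma acc_mono t u : t <= u <= K -> acc s t \subset acc s u.
Proof.
case/andP=> /subnK <-; elim: (u - t) => [|d IHd] //= dK.
exact: subset_trans (IHd (ltnW dK)) (acc_subS dK).
Qed.

(** By monotonicity the item lies in the retained set of every round after [t], where [sched_cert]
    copies the previous certificate. *)
Lemma cert_retained t u i :
  t <= u <= K -> i \in acc s t -> cert s u i = cert s t i.
Proof.
case/andP=> /subnK <- + it; elim: (u - t) => [|d IHd] //= dK.
rewrite addSn (sched_cert hs) //= ifT ?IHd 1?ltnW //.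
by apply: (subsetP (acc_mono _)) it; rewrite leq_addl ltnW.
Qed.

Lemma acc_accepts t i :
  t <= K -> i \in acc s t -> accepts V key (inst i) (cert s t i).
Proof.
elim: t => [|t IHt] tK; rewrite (sched_acc hs tK) !inE //=.
case/orP=> [it|/andP[] //].
by rewrite (@cert_retained t) ?leqnSn ?IHt // ltnW.
Qed.

Lemma cert_fresh t i :
  t <= K -> i \notin retained s t -> cert s t i = gen t i (memory s t).
Proof. by move=> tK it; rewrite (sched_cert hs) // (negbTE it). Qed.

(** The least accepting round works: it is positive by the second hypothesis, and its minimality
    excludes the round before. *)
Lemma acc_first_round i : i \in acc s K -> i \notin acc s 0 ->
  exists t, [/\ 0 < t <= K, i \in acc s t & i \notin retained s t].
Proof.
move=> iK i0; have exi : exists t, i \in acc s t by exists K.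
case: (ex_minnP exi) => -[|t] it min_t; first by rewrite it in i0.
exists t.+1; split=> //=; first exact: min_t.
by apply/negP => /min_t; rewrite ltnn.
Qed.

Lemma driven_itemsE (correct : X -> Ans -> Prop) (answer : C -> Ans) :
  sound_checker correct answer V ->
  driven_items inst correct answer V gen key K s = acc s K :\: acc s 0.
Proof.
move=> hsound; apply/setP => i; rewrite !inE.
have [//|i0] /= := boolP (i \in acc s 0).
apply/asboolP/idP => [[t [/andP[t0 tK] certK ok _]]|iK]; last first.
  have [t [/andP[t0 tK] it iNt]] := acc_first_round iK i0.
  (* At its entry round the item was open, so the certificate it holds is the fresh proposal, and it
     stays frozen until [K]. *)
  exists t; rewrite -cert_fresh // t0 tK (@cert_retained t) ?tK ?leqnn //.
  have ok := acc_accepts tK it; split=> //; exact: hsound ok.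
(* Round [K] alone decides: the certificate held there is accepted, so the item is either retained
   or newly accepted. *)
rewrite (sched_acc hs (leqnn K)) !inE certK ok andbT; exact: orbN.
Qed.

Lemma reads_nil t : oracle_free V -> t <= K -> reads s t = [::].
Proof.
move=> hfree; have no_reads u : round_reads inst V key s u = [::].
  by rewrite /round_reads; elim: (enum _) => //= i l ->; rewrite hfree.
elim: t => [|t IHt] tK; first by rewrite (sched_reads0 hs) no_reads.
by rewrite (sched_readsS hs tK) IHt 1?ltnW // no_reads.
Qed.

End OneTrace.

Section KeyIndependence.
Variables (key key' : X -> Ans) (s s' : trace T X C Rsn).
Hypothesis hfree : oracle_free V.
Hypothesis hs : aversive_schedule inst V gen key kappa nu K s.
Hypothesis hs' : aversive_schedule inst V gen key' kappa nu K s'.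

(** Accepted sets, certificates and memory depend on the key only through this outcome. *)
Let outcomeE x c : outcome key' (V x c) = outcome key (V x c).
Proof. exact/outcome_no_queries/hfree. Qed.

Lemma newly_accepted_key t :
  retained s' t = retained s t -> cert s' t =1 cert s t ->
  newly_accepted inst V key' s' t = newly_accepted inst V key s t.
Proof.
by move=> eqr eqc; apply/setP => i; rewrite !inE eqr eqc /accepts outcomeE.
Qed.

Lemma round_rejections_key t :
  retained s' t = retained s t -> cert s' t =1 cert s t ->
  round_rejections inst V key' s' t = round_rejections inst V key s t.
Proof.
move=> eqr eqc; rewrite /round_rejections eqr; apply: eq_pmap => i.
by rewrite eqc outcomeE.
Qed.

Lemma schedule_key_independent t : t <= K ->
  [/\ acc s' t = acc s t, cert s' t =1 cert s t & memory s' t = memory s t].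
Proof.
(* The memory entering round t.+1 depends on [retained s t], that is on
   A_(t-1), which the induction hypothesis must therefore carry. *)
suff H : t <= K -> [/\ acc s' t = acc s t, cert s' t =1 cert s t,
    memory s' t = memory s t & retained s' t = retained s t].
  by move=> /H[].
elim: t => [|t IHt] tK.
  have eqm : memory s' 0 = memory s 0.
    by rewrite (sched_mem0 hs) (sched_mem0 hs').
  have eqc : cert s' 0 =1 cert s 0.
    by move=> i; rewrite (cert_fresh hs) ?(cert_fresh hs') ?inE // eqm.
  split=> //; rewrite (sched_acc hs) // (sched_acc hs') //.
  by rewrite newly_accepted_key.
have [eqa eqc eqm eqr] := IHt (ltnW tK).
have eqmS : memory s' t.+1 = memory s t.+1.
  rewrite (sched_memS hs) // (sched_memS hs') // eqm.
  by rewrite round_rejections_key.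
have eqcS : cert s' t.+1 =1 cert s t.+1.
  by move=> i; rewrite (sched_cert hs) // (sched_cert hs') //= eqa eqc eqmS.
split=> //; rewrite (sched_acc hs) // (sched_acc hs') //=.
by rewrite eqa newly_accepted_key.
Qed.

End KeyIndependence.
End ScheduleTheory.

Theorem proposition7p8
  (R : realFieldType) (T : finType) (X C : countType) (Ans Rsn : Type)
  (inst : T -> X) (correct : X -> Ans -> Prop) (answer : C -> Ans)
  (V : checker X C Ans Rsn)
  (hcomp : computable_checker V)
  (hsound : sound_checker correct answer V)
  (hfree : oracle_free V)
  (kappa nu : R) (gen : generator T C Rsn) (K : nat)
  (key : X -> Ans) (s : trace T X C Rsn)
  (hs : aversive_schedule inst V gen key kappa nu K s) :
  [/\ (* (i) *)
      forall t, t < K -> acc s t \subset acc s t.+1,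
      (* (ii) *)
      forall t i, t <= K -> i \in acc s t ->
        accepts V key (inst i) (cert s t i) /\
        correct (inst i) (answer (cert s t i)),
      (* (iii) *)
      (forall t u, t <= u <= K -> #|acc s t| <= #|acc s u|) /\
      (forall t, t <= K ->
         #|acc s t| <= num_correct inst correct answer s t /\
         (#|acc s t|%:R / #|T|%:R <= true_accuracy inst correct answer R s t)%R) &
      (* (iv) *)
      [/\ forall t, t <= K -> reads s t = [::],
          forall (key' : X -> Ans) (s' : trace T X C Rsn),
            aversive_schedule inst V gen key' kappa nu K s' ->
            forall t, t <= K ->
              [/\ acc s' t = acc s t, cert s' t =1 cert s t
                & memory s' t = memory s t]
        & #|acc s K| - #|acc s 0| =
            #|driven_items inst correct answer V gen key K s| ]].
Proof.
have hacc t i : t <= K -> i \in acc s t ->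
    accepts V key (inst i) (cert s t i) /\
    correct (inst i) (answer (cert s t i)).
  by move=> tK it; have ok := acc_accepts hs tK it; split=> //; apply: hsound ok.
split=> //; first by move=> t; apply: (acc_subS hs).
- split=> [t u tuK|t tK]; first exact/subset_leq_card/(acc_mono hs).
  have le_acc : #|acc s t| <= num_correct inst correct answer s t.
    apply/subset_leq_card/subsetP => i it; rewrite inE.
    by apply/asboolP; case: (hacc _ _ tK it).
  (* An empty [T] needs no separate case, since the inverse of 0 is 0 and hence nonnegative. *)
  by split=> //; rewrite ler_wpM2r ?invr_ge0 ?ler0n // ler_nat.
split=> [t tK|key' s' hs' t tK|]; first exact: (reads_nil hs).
  exact: (schedule_key_independent hfree hs hs').
(* The inclusion of [acc s 0] in [acc s K] makes the truncated subtraction an exact count. *)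
rewrite (driven_itemsE hs hsound) cardsD (setIidPr _) //.
by apply: (acc_mono hs); rewrite leqnn.
Qed.
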